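(* Let $n\ge 2$ and let $a_1,\dots,a_n$ be commuting indeterminates. Let $C$ be the $n\times n$ tridiagonal matrix with diagonal entries $C_{ii}=a_i$ for $1\le i\le n$, with $C_{i,i+1}=C_{i+1,i}=1$ for $1\le i\le n-1$, and with all other entries $0$. Let $E$ be the $n\times n$ skew-symmetric matrix with $E_{1n}=1$, $E_{n1}=-1$, and all other entries $0$. Then the determinant of the $2n\times 2n$ skew-symmetric matrix $$\Omega=\begin{pmatrix} E & C\\ -C & E\end{pmatrix}$$ satisfies $$\det(\Omega)=R_n(a_1,\dots,a_n)^2,$$ where $R_n$ is the rotundus polynomial; that is, $R_n$ is (up to sign) the Pfaffian of $\Omega$.
   Context: The continuant $K_n(a_1,\dots,a_n)$ is the determinant of the $n\times n$ tridiagonal matrix with diagonal entries $a_1,\dots,a_n$, all entries immediately above and below the diagonal equal to $1$, and all other entries $0$; by convention $K_0=1$ and $K_{-1}=0$. The rotundus is the polynomial $R_n(a_1,\dots,a_n):=K_n(a_1,\dots,a_n)-K_{n-2}(a_2,\dots,a_{n-1})$. The determinant of a skew-symmetric matrix $\Omega$ is the square of a polynomial $\mathrm{pf}(\Omega)$ in its entries, called its Pfaffian; here it is understood through $\det(\Omega)=\mathrm{pf}(\Omega)^2$, i.e. up to sign. *)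

(* Defs.v *)
From HB Require Import structures.
From mathcomp Require Import all_boot all_order all_algebra.
From mathcomp Require Import mpoly.

Set Implicit Arguments.
Unset Strict Implicit.
Unset Printing Implicit Defensive.

Import GRing.Theory.
Local Open Scope ring_scope.

(* Indices are 0-based throughout: the families a : 'I_n -> A below carry
   a_1, ..., a_n as a 0, ..., a (n - 1). *)

Definition tridiag (A : comNzRingType) (n : nat) (a : 'I_n -> A) : 'M[A]_n :=
  \matrix_(i < n, j < n)
    if i == j then a i
    else if (j == i.+1 :> nat) || (i == j.+1 :> nat) then 1 else 0.

(* For n = 0 this is the determinant of the empty matrix, i.e. K_0 = 1. *)
Definition continuant (A : comNzRingType) (n : nat) (a : 'I_n -> A) : A :=
  \det (tridiag a).

Lemma inner_ord_proof (n : nat) (i : 'I_(n - 2)) : (i.+1 < n)%N.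
Proof. by have := ltn_ord i; rewrite ltn_subRL add2n => /ltnW. Qed.

Definition inner_ord (n : nat) (i : 'I_(n - 2)) : 'I_n :=
  Ordinal (inner_ord_proof i).

(* The second term is K_(n-2)(a_2, ..., a_(n-1)). The else branch is the
   convention K_(-1) = 0, which truncated subtraction would miss at n = 1. *)
Definition rotundus (A : comNzRingType) (n : nat) (a : 'I_n -> A) : A :=
  continuant a
  - (if (1 < n)%N then continuant (fun i : 'I_(n - 2) => a (inner_ord i))
     else 0).

Definition corner (A : comNzRingType) (n : nat) : 'M[A]_n :=
  \matrix_(i < n, j < n)
    if (i == 0 :> nat) && (j == n.-1 :> nat) then 1
    else if (i == n.-1 :> nat) && (j == 0 :> nat) then -1
    else 0.

Definition rotundus_mx (A : comNzRingType) (n : nat) (a : 'I_n -> A) :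
    'M[A]_(n + n) :=
  block_mx (corner A n) (tridiag a) (- tridiag a) (corner A n).

(* The zero diagonal follows from M^T = - M except in characteristic 2. *)
Definition skew_symmetric (A : comNzRingType) (m : nat) (M : 'M[A]_m) : Prop :=
  M^T = - M /\ (forall i, M i i = 0).

(* The Pfaffian is taken up to sign, as a square root of the determinant; over
   an integral domain such a root is unique up to sign. *)
Definition is_pfaffian (A : comNzRingType) (m : nat) (M : 'M[A]_m) (p : A) :
    Prop :=
  skew_symmetric M /\ \det M = p ^+ 2.

(* Main.v *)
(** Adjoin a square root [i] of [-1] to the ground ring, by passing to the
    quotient of [A[X]] by [X^2 + 1].  There
    [det Omega = det (E - i C) * det (E + i C) = det (C + i E) * det (C - i E)].
    Each factor is the determinant of the tridiagonal matrix [C] with two extra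
    corner entries [x = +-i] and [y = -x].  Expanding in the corners,
    [det = K_n(a_1, ..., a_n) +- (x + y) - x y K_(n-2)(a_2, ..., a_(n-1))],
    and since [x + y = 0] and [x y = 1] both factors are equal to the
    rotundus. *)
Require Import Defs.
From HB Require Import structures.
From mathcomp Require Import all_boot all_order all_algebra.
From mathcomp Require Import mpoly.
From mathcomp Require Import ring zify.

Set Implicit Arguments.
Unset Strict Implicit.
Unset Printing Implicit Defensive.

Import GRing.Theory.
Local Open Scope ring_scope.

(** The determinant is affine in each entry: the cofactors along row [i] are computed without row
    [i], so changing that row leaves them intact. *)
Lemma det_add_delta (A : comNzRingType) (n : nat) (M : 'M[A]_n) (x : A)
    (i j : 'I_n) :
  \det (M + x *: delta_mx i j) = \det M + x * cofactor M i j.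
Proof.
rewrite (expand_det_row _ i) (expand_det_row M i).
have cofE k : cofactor (M + x *: delta_mx i j) i k = cofactor M i k.
  rewrite /cofactor; congr (_ * \det _); apply/matrixP => u v.
  by rewrite !mxE eq_sym (negPf (neq_lift _ _)) mulr0 addr0.
under eq_bigr do rewrite cofE !mxE eqxx mulrDl.
rewrite big_split /=; congr (_ + _).
rewrite (bigD1 j) //= eqxx mulr1 big1 ?addr0 // => k /negPf ->.
by rewrite mulr0 mul0r.
Qed.

Lemma tridiag_tr (A : comNzRingType) (n : nat) (a : 'I_n -> A) :
  (tridiag a)^T = tridiag a.
Proof.
by apply/matrixP => i j; rewrite !mxE eq_sym orbC; case: eqP => [->|].
Qed.

(** Removing the first row and last column shifts the subdiagonal of ones onto the diagonal, and
    everything below it vanishes. *)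
Lemma det_tridiag_minor (A : comNzRingType) (n : nat) (a : 'I_n.+1 -> A) :
  \det (row' ord0 (col' ord_max (tridiag a))) = 1.
Proof.
have minorE (i j : 'I_n) : row' ord0 (col' ord_max (tridiag a)) i j
    = if i.+1 == j :> nat then a (lift ord0 i)
      else if (j == i.+2 :> nat) || (i == j :> nat) then 1 else 0.
  by rewrite !mxE -val_eqE lift0 lift_max /= /bump leq0n leqNgt ltn_ord.
(* The minor is upper triangular while [det_trig] expects a lower triangular matrix, hence the
   transpose. *)
rewrite -det_tr (@det_trig _ n) => [|]; last first.
  apply/is_trig_mxP => i j ij; rewrite mxE minorE.
  by do 3?[case: eqP => /= ? //]; exfalso; lia.
rewrite big1 // => i _; rewrite mxE minorE eqxx orbT.
by case: eqP => //= ?; exfalso; lia.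
Qed.

Lemma det_tridiag_corners (A : comNzRingType) (n : nat) (a : 'I_n.+2 -> A)
    (x y : A) :
  \det (tridiag a + y *: delta_mx ord_max ord0 + x *: delta_mx ord0 ord_max)
    = continuant a + (-1) ^+ n.+1 * (x + y)
      - x * y * continuant (fun i : 'I_n => a (lift ord0 (lift ord_max i))).
Proof.
(* By symmetry of [tridiag a], both corners have the same cofactor in it. *)
rewrite !det_add_delta -[cofactor (tridiag a) _ _]cofactor_tr tridiag_tr.
rewrite /cofactor det_tridiag_minor /= add0n.
set M := row' ord0 _.
(* The entry [y] survives in the minor at [x], as its bottom left corner; expanding there once more
   produces the [x * y] term. *)
have -> : M = row' ord0 (col' ord_max (tridiag a))
              + y *: delta_mx ord_max ord0 :> 'M_n.+1.
  apply/matrixP => i j; rewrite !mxE; congr (_ + _ * (_ && _)%:R).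
  by rewrite -!val_eqE /= /bump leqNgt ltn_ord.
rewrite det_add_delta det_tridiag_minor /cofactor /= addn0.
set N := row' ord_max _.
have -> : N = tridiag (fun i : 'I_n => a (lift ord0 (lift ord_max i))).
  have liftE (k : 'I_n) :
      lift ord_max (lift ord0 k) = lift ord0 (lift ord_max k).
    by apply: val_inj; rewrite /= /bump /= !add1n ltnS leqNgt ltn_ord.
  apply/matrixP => i j; rewrite !mxE liftE !(inj_eq lift_inj) !lift0 !lift_max.
  by rewrite !eqSS.
(* The two nested cofactors carry the signs [(-1) ^+ n.+1] and [(-1) ^+ n], whose product is
   [-1]. *)
rewrite /continuant exprS; have := sqrr_sign A n; move: ((-1) ^+ n) => s s2.
ring: s2.
Qed.

(** Add [u] times the second block row to the first, then subtract [u] times the first block column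
    from the second. Since [u ^+ 2 = -1], the upper right block cancels and the diagonal blocks
    become [- u] and [u] times the two factors. These scalars contribute [(- u * u) ^+ n = 1]. *)
Lemma det_block_sqrtN1 (A : comNzRingType) (n : nat) (u : A) (M N : 'M[A]_n) :
  u ^+ 2 = -1 ->
  \det (block_mx M N (- N) M) = \det (N + u *: M) * \det (N - u *: M).
Proof.
move=> u2.
have uu : u * u = -1 by rewrite -expr2.
pose U v := block_mx 1%:M v%:M 0 (1%:M : 'M[A]_n) : 'M_(n + n).
have detU v : \det (U v) = 1 by rewrite det_ublock !det1 mulr1.
have UMU : U u *m block_mx M N (- N) M *m U (- u)
           = block_mx (- u *: (N + u *: M)) 0 (- N) (u *: (N - u *: M)).
  rewrite /U !mulmx_block !mul1mx !mul0mx !mulmx1 !mulmx0 !addr0 !add0r.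
  rewrite !mul_scalar_mx !mul_mx_scalar !scalerDr !scalerN !scaleNr !scalerA.
  rewrite uu !scaleN1r !opprK [M - _]addrC [N + _]addrC.
  by rewrite -opprD addNr.
have -> : \det (block_mx M N (- N) M)
          = \det (U u *m block_mx M N (- N) M *m U (- u)).
  by rewrite !det_mulmx !detU mul1r mulr1.
by rewrite UMU det_lblock !detZ mulrACA -exprMn mulNr uu opprK expr1n mul1r.
Qed.

Lemma eq_continuant (A : comNzRingType) (m n : nat) (e : m = n)
    (a : 'I_m -> A) (b : 'I_n -> A) :
  (forall i, a i = b (cast_ord e i)) -> continuant a = continuant b.
Proof.
case: n / e b => b ab; congr (\det _); apply/matrixP => i j.
by rewrite !mxE ab cast_ord_id.
Qed.

Lemma rotundusSS (A : comNzRingType) (n : nat) (a : 'I_n.+2 -> A) :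
  rotundus a = continuant a
    - continuant (fun i : 'I_n => a (lift ord0 (lift ord_max i))).
Proof.
rewrite /rotundus ltnS ltn0Sn; congr (_ - _).
have e : (n.+2 - 2 = n)%N by rewrite subn2.
apply: (eq_continuant (e := e)) => i; congr a; apply: ord_inj.
by rewrite lift0 lift_max.
Qed.

Lemma corner_delta (A : comNzRingType) (n : nat) :
  corner A n.+2 = delta_mx ord0 ord_max - delta_mx ord_max ord0.
Proof.
apply/matrixP => i j; rewrite !mxE -!val_eqE /=.
case: eqP => [->|_] /=; first by case: eqP => _ //=; rewrite ?subr0.
by rewrite sub0r; case: ifP; rewrite ?oppr0.
Qed.

Lemma det_rotundus_mx_sqrtN1 (A : comNzRingType) (n : nat) (u : A)
    (a : 'I_n.+2 -> A) :
  u ^+ 2 = -1 -> \det (rotundus_mx a) = rotundus a ^+ 2.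
Proof.
move=> u2.
have detC v : v ^+ 2 = -1 ->
    \det (tridiag a + v *: corner A n.+2) = rotundus a.
  move=> v2; rewrite corner_delta scalerBr [_ *: _ - _]addrC addrA -scaleNr.
  by rewrite det_tridiag_corners subrr mulr0 addr0 mulrN -expr2 v2 opprK mul1r
             rotundusSS.
by rewrite (det_block_sqrtN1 _ _ u2) -scaleNr !detC ?sqrrN.
Qed.

(** This and the next four lemmas allow the identity to be checked after extending scalars. *)
Lemma map_tridiag (A B : comNzRingType) (f : {rmorphism A -> B}) (n : nat)
    (a : 'I_n -> A) :
  map_mx f (tridiag a) = tridiag (f \o a).
Proof.
by apply/matrixP => i j; rewrite !mxE; do 2?case: ifP => // _;
   rewrite ?rmorph1 ?rmorph0.
Qed.

Lemma map_corner (A B : comNzRingType) (f : {rmorphism A -> B}) (n : nat) :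
  map_mx f (corner A n) = corner B n.
Proof.
by apply/matrixP => i j; rewrite !mxE; do 2?case: ifP => // _;
   rewrite ?rmorphN ?rmorph1 ?rmorph0.
Qed.

Lemma map_rotundus_mx (A B : comNzRingType) (f : {rmorphism A -> B}) (n : nat)
    (a : 'I_n -> A) :
  map_mx f (rotundus_mx a) = rotundus_mx (f \o a).
Proof. by rewrite map_block_mx map_mxN map_corner map_tridiag. Qed.

Lemma rmorph_continuant (A B : comNzRingType) (f : {rmorphism A -> B}) (n : nat)
    (a : 'I_n -> A) :
  f (continuant a) = continuant (f \o a).
Proof. by rewrite -det_map_mx map_tridiag. Qed.

Lemma rmorph_rotundus (A B : comNzRingType) (f : {rmorphism A -> B}) (n : nat)
    (a : 'I_n -> A) :
  f (rotundus a) = rotundus (f \o a).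
Proof.
by rewrite /rotundus rmorphB rmorph_continuant; case: ifP => _;
   rewrite ?rmorph0 ?rmorph_continuant.
Qed.

Lemma qpolyX_sqrtN1 (A : comNzRingType) :
  ('qX : {poly %/ 'X^2 + (1 : A)%:P}) ^+ 2 = -1.
Proof.
set h := 'X^2 + _.
have h_monic : h \is monic by apply: monicXnaddC.
have h_size : size h = 3 by rewrite size_XnaddC.
(* The quotient is taken by [mk_monic h], which defaults to ['X] unless [h] is monic and
   nonconstant. *)
have hE : mk_monic h = h by rewrite /mk_monic h_size h_monic.
have : in_qpoly h ('X^2 + 1) = 0.
  by apply: val_inj; rewrite /= hE -polyC1 -/h Pdiv.RingMonic.rmodpp.
by rewrite rmorphD rmorphXn rmorph1 => /eqP; rewrite addr_eq0 => /eqP.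
Qed.

(** The ring [A] embeds as constants in its extension by a root of ['X^2 + 1], so the identity
    proved there descends to [A]. *)
Lemma det_rotundus_mx (A : comNzRingType) (n : nat) (a : 'I_n -> A) :
  (1 < n)%N -> \det (rotundus_mx a) = rotundus a ^+ 2.
Proof.
case: n a => [|[|n]] // a _.
pose h : {poly A} := 'X^2 + 1%:P.
have qC_inj : injective (qpolyC h).
  by move=> c d /(congr1 val) /polyC_inj.
apply: qC_inj; rewrite -det_map_mx map_rotundus_mx rmorphXn rmorph_rotundus.
exact: det_rotundus_mx_sqrtN1 (qpolyX_sqrtN1 A).
Qed.

Lemma corner_tr (A : comNzRingType) (n : nat) :
  (1 < n)%N -> (corner A n)^T = - corner A n.
Proof.
case: n => [|[|n]] // _.
by rewrite corner_delta linearB /= !trmx_delta opprB.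
Qed.

Lemma skew_rotundus_mx (A : comNzRingType) (n : nat) (a : 'I_n -> A) :
  (1 < n)%N -> skew_symmetric (rotundus_mx a).
Proof.
move=> n_gt1; split.
  rewrite tr_block_mx opp_block_mx linearN /= tridiag_tr corner_tr //.
  by rewrite opprK.
(* For [1 < n] the two nonzero corners lie off the diagonal; at [n = 1] they would collide on it. *)
have corner_diag i : corner A n i i = 0.
  by rewrite mxE; have := ltn_ord i; do 3?[case: eqP => //= ?]; lia.
by move=> k; rewrite -[k]splitK; case: (split k) => i /=;
   rewrite ?block_mxEul ?block_mxEdr corner_diag.
Qed.

Theorem theorem1 (R : idomainType) (n : nat) (hn : (2 <= n)%N) :
  let a : 'I_n -> {mpoly R[n]} := fun i => 'X_i in
  let Omega := rotundus_mx a in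
  [/\ skew_symmetric Omega,
      \det Omega = rotundus a ^+ 2
    & forall p : {mpoly R[n]},
        is_pfaffian Omega p <-> p = rotundus a \/ p = - rotundus a].
Proof.
move=> a Omega.
have skew : skew_symmetric Omega by apply: skew_rotundus_mx.
have detO : \det Omega = rotundus a ^+ 2 by apply: det_rotundus_mx.
split=> // p; split=> [[_]|pE].
  (* Polynomials over a domain form a domain, so equal squares agree up to sign. *)
  rewrite detO => /esym/eqP; rewrite eqf_sqr.
  by case/orP => /eqP; [left | right].
by split=> //; rewrite detO; case: pE => ->; rewrite ?sqrrN.
Qed.
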